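(* Let $n\ge 4$ and let $x_1,x_2,\dots,x_n$ be $n$ positive real numbers, with arithmetic mean $A$, geometric mean $G$, harmonic mean $H$ and second and third moments $m_2'$ and $m_3'$. Then $$G\leq \left(\frac{G^{n}}{H}\right)^{\frac{1}{n-1}}\leq A\left(\frac{n^{2}}{(n-1)(n-2)}\left(1-\frac{3}{n}\frac{m_{2}'}{A^{2}}+\frac{2}{n^{2}}\frac{m_{3}'}{A^{3}}\right)\right)^{\frac13}.$$
   Context: For positive real numbers $x_1,\dots,x_n$: $A=\frac1n\sum_{i=1}^n x_i$, $G=\left(\prod_{i=1}^n x_i\right)^{1/n}$, $H=\left(\frac1n\sum_{i=1}^n\frac1{x_i}\right)^{-1}$, and $m_r'=\frac1n\sum_{i=1}^n x_i^r$ for $r=2,3$. *)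

(* Defs.v *)
From mathcomp Require Import all_boot all_order all_algebra.
From mathcomp Require Import reals exp.

Set Implicit Arguments.
Unset Strict Implicit.
Unset Printing Implicit Defensive.

Import Order.TTheory GRing.Theory Num.Theory.
Local Open Scope ring_scope.

Definition amean (R : realType) (n : nat) (x : 'I_n -> R) : R :=
  n%:R^-1 * \sum_(i < n) x i.

Definition gmean (R : realType) (n : nat) (x : 'I_n -> R) : R :=
  (\prod_(i < n) x i) `^ (n%:R^-1).

Definition hmean (R : realType) (n : nat) (x : 'I_n -> R) : R :=
  (n%:R^-1 * \sum_(i < n) (x i)^-1)^-1.

(* Raw (non-central) moment: m'_r is the mean of the r-th powers. *)
Definition raw_moment (R : realType) (n : nat) (r : nat) (x : 'I_n -> R) : R :=
  n%:R^-1 * \sum_(i < n) x i ^+ r.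

(* Main.v *)
Require Import Defs.
From mathcomp Require Import all_boot all_order all_algebra.
From mathcomp Require Import reals exp.
From mathcomp Require Import ring lra.

Set Implicit Arguments.
Unset Strict Implicit.
Unset Printing Implicit Defensive.

Import Order.TTheory GRing.Theory Num.Theory.
Local Open Scope ring_scope.

(** Let [E_k] be the mean of all products of [k] of the [x_i]. The three
quantities of the theorem are [E_n^(1/n)], [E_(n-1)^(1/(n-1))] and
[E_3^(1/3)] (by Newton's identity for the third elementary symmetric
polynomial), so both inequalities are instances of Maclaurin's inequality.
The latter follows from Newton's inequality [E_k E_(k+2) <= E_(k+1)^2], which
is proved by adding the variables one at a time: if [E'] is the sequence
obtained after adding the variable [a], making [n] variables in all, then
[n^2 (E'_(k+1)^2 - E'_k E'_(k+2)) >= (E_(k+1) - a E_k)^2]. *)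

(* In terms of [e_k := 'C(m, k) E_k], with [m] the number of variables, the
recursion is [e'_(k+1) = e_(k+1) + a e_k], so [e_k] is the [k]-th elementary
symmetric polynomial. For [k > m] the value of [E_k] is 0. *)
Fixpoint symmean (R : fieldType) (s : seq R) (k : nat) : R :=
  match s, k with
  | _, 0%N => 1
  | [::], _ => 0
  | a :: s', k'.+1 =>
      (((size s')%:R - k'%:R) * symmean s' k'.+1
       + k'.+1%:R * a * symmean s' k') / (size s').+1%:R
  end.

Section SymmetricMeans.
Variable R : realFieldType.
Implicit Types (s : seq R) (k : nat).

Lemma symmean0 s : symmean s 0 = 1.
Proof. by case: s. Qed.

Lemma symmeanS a s k :
  (size s).+1%:R * symmean (a :: s) k.+1 =
  ((size s)%:R - k%:R) * symmean s k.+1 + k.+1%:R * a * symmean s k.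
Proof. by rewrite /= mulrC divfK ?pnatr_eq0. Qed.

Lemma symmean_oversize s k : (size s < k)%N -> symmean s k = 0.
Proof.
elim: s k => [|a s IHs] [|k] //= ltsk.
by rewrite !IHs ?(ltnW ltsk) ?mulr0 ?addr0 ?mul0r.
Qed.

Lemma symmean_gt0 s k :
  all (fun a => 0 < a) s -> (k <= size s)%N -> 0 < symmean s k.
Proof.
elim: s k => [|a s IHs] [|k] //= /andP[a0 s0] leks.
rewrite divr_gt0 ?ltr0Sn// ltr_wpDl ?mulr_gt0 ?ltr0Sn ?IHs//.
(* If [k = size s], the induction hypothesis does not reach [symmean s k.+1], but its coefficient
   vanishes. *)
move: leks; rewrite ltnS leq_eqVlt => /predU1P[->|ltks].
  by rewrite subrr mul0r.
by rewrite mulr_ge0 ?subr_ge0 ?ler_nat ?(ltnW ltks)// ltW ?IHs.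
Qed.

(** Here [u, v, w, z] stand for [E_j, ..., E_(j+3)] of [m] variables, and the three linear forms are
    [m + 1] times [E_(j+1)], [E_(j+3)] and [E_(j+2)] after [a] is added. The right side exceeds the
    left by [(w - a v)^2] plus nonnegative multiples of [w^2 - v z], [v w - u z] and [v^2 - u w]. *)
Lemma newton_step (m j a u v w z : R) : 0 <= a -> 0 <= j -> j + 2 <= m ->
    0 <= u -> 0 < v -> 0 < w -> 0 <= z -> u * w <= v ^+ 2 -> v * z <= w ^+ 2 ->
  ((m - j) * v + (j + 1) * a * u) * ((m - (j + 2)) * z + (j + 3) * a * w) <=
  ((m - (j + 1)) * w + (j + 2) * a * v) ^+ 2.
Proof.
move=> a0 j0 jm u0 v0 w0 z0 uw vz.
have uz : u * z <= v * w.
  (* Multiply the hypotheses [uw] and [vz], then cancel [v * w]. *)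
  rewrite -(ler_pM2r (mulr_gt0 v0 w0)).
  have -> : u * z * (v * w) = u * w * (v * z) by ring.
  have -> : v * w * (v * w) = v ^+ 2 * w ^+ 2 by ring.
  by apply: ler_pM => //; rewrite mulr_ge0 // ltW.
rewrite -subr_ge0.
have -> : ((m - (j + 1)) * w + (j + 2) * a * v) ^+ 2 -
  ((m - j) * v + (j + 1) * a * u) * ((m - (j + 2)) * z + (j + 3) * a * w) =
  (w - a * v) ^+ 2 + (m - j) * (m - (j + 2)) * (w ^+ 2 - v * z)
  + (j + 1) * (m - (j + 2)) * a * (v * w - u * z)
  + (j + 1) * (j + 3) * a ^+ 2 * (v ^+ 2 - u * w) by ring.
by rewrite !addr_ge0 ?sqr_ge0 //; repeat apply: mulr_ge0 => //; lra.
Qed.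

Lemma newton_inequality s k : all (fun a => 0 < a) s ->
  symmean s k * symmean s k.+2 <= symmean s k.+1 ^+ 2.
Proof.
elim: s k => [|a s IHs] k s0; first by rewrite /= mulr0 expr0n.
have [ltsk|] := ltnP (size s).+1 k.+2.
  by rewrite (@symmean_oversize _ k.+2) ?mulr0 ?sqr_ge0.
have /andP[a0 {}s0] := s0; rewrite !ltnS => ltks.
have n2_gt0 : 0 < (size s).+1%:R ^+ 2 :> R by rewrite exprn_gt0 ?ltr0Sn.
rewrite -(ler_pM2l n2_gt0) -exprMn symmeanS.
have Eks i : (i <= size s)%N -> 0 < symmean s i by apply: symmean_gt0.
have E_ge0 i : 0 <= symmean s i.
  by have [/symmean_oversize->|/Eks/ltW] := ltnP (size s) i.
have := IHs k s0; case: k ltks => [|j] ltks.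
  (* The recursion does not cover [E'_0 = 1], so [k = 0] needs its own identity. *)
  rewrite !symmean0 !mul1r mulr1 expr2 -mulrA symmeanS => E2.
  rewrite -subr_ge0; set m := (size s)%:R.
  have mE : (size s).+1%:R = m + 1 by rewrite -natr1.
  have -> : (m - 0%:R) * symmean s 1 + a = m * symmean s 1 + a by rewrite subr0.
  have m1 : 1 <= m by rewrite ler1n.
  rewrite mE; set e1 := symmean s 1 in E2 *; set e2 := symmean s 2 in E2 *.
  have -> : (m * e1 + a) ^+ 2 - (m + 1) * ((m - 1) * e2 + 2 * a * e1) =
    (m + 1) * (m - 1) * (e1 ^+ 2 - e2) + (e1 - a) ^+ 2 by ring.
  by rewrite addr_ge0 ?sqr_ge0 // !mulr_ge0 ?subr_ge0 //; lra.
move=> Ej1; have -> : (size s).+1%:R ^+ 2 *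
    (symmean (a :: s) j.+1 * symmean (a :: s) j.+3) =
    ((size s).+1%:R * symmean (a :: s) j.+1) *
    ((size s).+1%:R * symmean (a :: s) j.+3) by ring.
rewrite !symmeanS -[j.+1%:R]natr1 -[j.+2%:R]natr1 -[j.+3%:R]natr1.
rewrite -[j.+2%:R]natr1 -[j.+1%:R]natr1 -!addrA.
have -> : 1 + 1 = 2 :> R by ring.
have -> : 1 + 2 = 3 :> R by ring.
apply: newton_step; rewrite ?E_ge0 ?Eks ?(ltW a0) ?ler0n ?IHs ?(ltnW ltks) //.
by rewrite -natrD addn2 ler_nat.
Qed.

(** After multiplication by [E_k^(k-1)], the previous case [E_k^(k-1) <= E_(k-1)^k] bounds the left
    side by [(E_(k-1) E_(k+1))^k], and Newton's inequality bounds this by [E_k^(2k)]. *)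
Lemma maclaurin_step s k : all (fun a => 0 < a) s -> (k < size s)%N ->
  symmean s k.+1 ^+ k <= symmean s k ^+ k.+1.
Proof.
move=> s0; elim: k => [|k IHk] ltks; first by rewrite symmean0 expr0 expr1n.
have Ek0 : 0 < symmean s k by rewrite symmean_gt0 // ltnW // ltnW.
have Ek1 : 0 < symmean s k.+1 by rewrite symmean_gt0 // ltnW.
have Ek2 : 0 < symmean s k.+2 by rewrite symmean_gt0.
rewrite -(ler_pM2l (exprn_gt0 k Ek1)) -exprD addnS -addnS.
apply: (@le_trans _ _ (symmean s k ^+ k.+1 * symmean s k.+2 ^+ k.+1)).
  by rewrite ler_wpM2r ?exprn_ge0 ?(ltW Ek2) // IHk // ltnW.
rewrite -exprMn addnS -addSn addnn -mul2n exprM.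
apply: lerXn2r; rewrite ?nnegrE ?newton_inequality ?sqr_ge0 //.
by rewrite mulr_ge0 ?(ltW Ek0) ?(ltW Ek2).
Qed.

Lemma symmean_size s : symmean s (size s) = \prod_(a <- s) a.
Proof.
elim: s => [|a s IHs]; first by rewrite big_nil.
have N0 : (size s).+1%:R != 0 :> R by rewrite pnatr_eq0.
by apply: (mulfI N0); rewrite big_cons symmeanS subrr mul0r add0r IHs mulrA.
Qed.

(** Both sides are [e_(n-1)]: a product omitting one variable is the full product divided by that
    variable. *)
Lemma symmean_pred_size s : all (fun a => 0 < a) s ->
  (size s)%:R * symmean s (size s).-1 =
  (\prod_(a <- s) a) * \sum_(a <- s) a^-1.
Proof.
elim: s => [_|a s IHs /andP[a0 s0]]; first by rewrite !big_nil mulr0 mul0r.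
rewrite !big_cons.
(* For a single variable the index is 0, where [symmeanS] does not apply. *)
case: s IHs s0 => [_ _|b s IHs s0].
  by rewrite !big_nil symmean0 !mulr1 addr0 divff ?gt_eqF.
have e := IHs s0; rewrite -[size _]/(size (b :: s)).+1 -pred_Sn.
rewrite [X in _ * symmean _ X = _]/= symmeanS.
rewrite [RHS]mulrDr [X in _ = X + _]mulrAC divff ?gt_eqF // mul1r.
rewrite -[in RHS]mulrA -{}e.
rewrite -symmean_size [size (b :: s)]/= -natr1; ring.
Qed.

Lemma symmean1 s : (size s)%:R * symmean s 1 = \sum_(a <- s) a.
Proof.
elim: s => [|a s IHs]; first by rewrite big_nil mul0r.
by rewrite big_cons symmeanS symmean0 subr0 IHs !(mul1r, mulr1) addrC.
Qed.

Lemma symmean2 s : (size s)%:R * ((size s)%:R - 1) * symmean s 2 =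
  (\sum_(a <- s) a) ^+ 2 - \sum_(a <- s) a ^+ 2.
Proof.
elim: s => [|a s IHs]; first by rewrite !big_nil mulr0 expr0n subrr.
rewrite -[size (a :: s)]/(size s).+1 !big_cons mulrAC symmeanS -symmean1 -natr1.
have -> : \sum_(a <- s) a ^+ 2 = (\sum_(a <- s) a) ^+ 2 -
  (size s)%:R * ((size s)%:R - 1) * symmean s 2 by rewrite IHs subKr.
rewrite -symmean1; ring.
Qed.

(** The left side is [6 e_3]. Adding [a] raises it by [3 a] times [2 e_2], which [symmean2]
    expresses in power sums. *)
Lemma symmean3 s :
  (size s)%:R * ((size s)%:R - 1) * ((size s)%:R - 2) * symmean s 3 =
  (\sum_(a <- s) a) ^+ 3 - 3 * (\sum_(a <- s) a) * (\sum_(a <- s) a ^+ 2)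
  + 2 * \sum_(a <- s) a ^+ 3.
Proof.
elim: s => [|a s IHs]; first by rewrite !big_nil mulr0 expr0n /= !mulr0 subrr addr0.
rewrite -[size (a :: s)]/(size s).+1 !big_cons mulrAC [X in X * _ = _]mulrAC symmeanS.
set p1 := \sum_(a <- s) a in IHs *; set p2 := \sum_(a <- s) a ^+ 2 in IHs *.
set p3 := \sum_(a <- s) a ^+ 3 in IHs *; set m := (size s)%:R in IHs *.
have e2 : m * (m - 1) * symmean s 2 = p1 ^+ 2 - p2 by rewrite symmean2.
have -> : (a + p1) ^+ 3 - 3 * (a + p1) * (a ^+ 2 + p2) + 2 * (a ^+ 3 + p3) =
  (p1 ^+ 3 - 3 * p1 * p2 + 2 * p3) + 3 * a * (p1 ^+ 2 - p2) by ring.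
by rewrite -IHs -e2 -natr1 -/m; ring.
Qed.

End SymmetricMeans.

Lemma maclaurin (R : realType) (s : seq R) (j k : nat) :
  all (fun a => 0 < a) s -> (0 < j <= k)%N -> (k <= size s)%N ->
  symmean s k `^ k%:R^-1 <= symmean s j `^ j%:R^-1.
Proof.
move=> s0 /andP[j0]; elim: k => [|k IHk]; first by rewrite leqNgt j0.
rewrite leq_eqVlt => /predU1P[->//|]; rewrite ltnS => lejk ltks.
apply: le_trans (IHk lejk (ltnW ltks)).
have k0 : (0 < k)%N by apply: leq_trans lejk.
have Ek : 0 <= symmean s k by rewrite ltW // symmean_gt0 // ltnW.
have Ek1 : 0 <= symmean s k.+1 by rewrite ltW // symmean_gt0.
(* Both sides are rewritten as powers with the common exponent [1/(k(k+1))], whose bases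
   [maclaurin_step] compares. *)
have -> : k.+1%:R^-1 = k%:R * (k%:R^-1 * k.+1%:R^-1) :> R.
  by rewrite mulVKf // pnatr_eq0 -lt0n.
have -> : symmean s k `^ k%:R^-1 =
    (symmean s k ^+ k.+1) `^ (k%:R^-1 * k.+1%:R^-1).
  by rewrite -powR_mulrn // -powRrM mulrCA mulfV ?pnatr_eq0 // mulr1.
rewrite powRrM powR_mulrn //.
apply: ge0_ler_powR; rewrite ?nnegrE ?exprn_ge0 ?mulr_ge0 ?invr_ge0 //.
exact: maclaurin_step.
Qed.

Theorem theorem2p6 (R : realType) (n : nat) (x : 'I_n -> R)
    (hn : (4 <= n)%N) (hx : forall i : 'I_n, 0 < x i) :
  gmean x <= (gmean x ^+ n / hmean x) `^ ((n%:R - 1)^-1) /\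
  (gmean x ^+ n / hmean x) `^ ((n%:R - 1)^-1) <=
    amean x *
    (n%:R ^+ 2 / ((n%:R - 1) * (n%:R - 2)) *
     (1 - 3 / n%:R * (raw_moment 2 x / amean x ^+ 2)
        + 2 / n%:R ^+ 2 * (raw_moment 3 x / amean x ^+ 3))) `^ (3^-1).
Proof.
have n_ge4 : 4 <= n%:R :> R by rewrite ler_nat.
have n_neq0 : n%:R != 0 :> R by lra.
pose s := [seq x i | i <- index_enum 'I_n].
have sz : size s = n by rewrite size_map [index_enum _]unlock -enumT size_enum_ord.
have s0 : all (fun a => 0 < a) s by apply/allP => _ /mapP[i _ ->].
have sumE (f : R -> R) : \sum_(a <- s) f a = \sum_i f (x i) by rewrite big_map.
have En : symmean s n = \prod_i x i by rewrite -[in LHS]sz symmean_size big_map.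
have P0 : 0 <= \prod_i x i by rewrite prodr_ge0 // => i _; rewrite ltW.
have En1 : symmean s n.-1 = gmean x ^+ n / hmean x.
  rewrite /gmean /hmean -powR_mulrn ?powR_ge0 // -powRrM mulVf // powRr1 //.
  rewrite invrK mulrCA -sumE -(big_map x xpredT id) -symmean_pred_size // sz.
  by rewrite mulKf.
have A0 : 0 < amean x.
  apply: mulr_gt0; first by rewrite invr_gt0; lra.
  rewrite -(sumE id) -symmean1 sz mulr_gt0 ?symmean_gt0 ?sz ?(leq_trans _ hn) //.
  by lra.
have E3 : amean x ^+ 3 * (n%:R ^+ 2 / ((n%:R - 1) * (n%:R - 2)) *
     (1 - 3 / n%:R * (raw_moment 2 x / amean x ^+ 2)
        + 2 / n%:R ^+ 2 * (raw_moment 3 x / amean x ^+ 3))) = symmean s 3.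
  (* The power sums are [n A], [n m'_2] and [n m'_3]; Newton's identity is then divided by
     [n(n-1)(n-2)]. *)
  have := symmean3 s; rewrite sz !sumE.
  have -> : \sum_i x i = n%:R * amean x by rewrite mulVKf.
  have -> : \sum_i x i ^+ 2 = n%:R * raw_moment 2 x by rewrite mulVKf.
  have -> : \sum_i x i ^+ 3 = n%:R * raw_moment 3 x by rewrite mulVKf.
  have n1 : n%:R - 1 != 0 :> R by lra.
  have n2 : n%:R - 2 != 0 :> R by lra.
  have n12 : n%:R * (n%:R - 1) * (n%:R - 2) != 0 :> R by rewrite !mulf_neq0.
  move=> e; apply: (mulfI n12); rewrite e; field.
  by rewrite n_neq0 n1 n2 gt_eqF.
have n1E : n%:R - 1 = n.-1%:R :> R by rewrite -subn1 natrB // (leq_trans _ hn).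
(* The two claims compare [E_n] with [E_(n-1)] and [E_(n-1)] with [E_3]; [hn] gives [3 <= n - 1]. *)
rewrite -En1 n1E in E3 *; split.
  rewrite /gmean -En; apply: maclaurin; rewrite ?sz ?leq_pred //.
  by rewrite ltn_predRL (leq_trans _ hn).
have A3 : amean x = (amean x ^+ 3) `^ 3^-1.
  by rewrite -powR_mulrn ?(ltW A0) // -powRrM mulfV ?pnatr_eq0 // powRr1 // ltW.
(* Moving [A] under the cube root requires the other factor to be nonnegative, which holds because
   [A^3] times it is [E_3]. *)
rewrite {1}A3 -powRM ?exprn_ge0 ?(ltW A0) //; last first.
  by rewrite -(pmulr_rge0 _ (exprn_gt0 3 A0)) E3 ltW // symmean_gt0 // sz ltnW.
rewrite E3; apply: maclaurin; rewrite ?sz ?leq_pred //.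
by rewrite ltn_predRL.
Qed.
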